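(* Let $\gamma<1$, $\beta_*:=\frac{1}{1-\gamma}$ and $\theta:=2^{\gamma-1}$. For every $\beta>\beta_*$, let $\mu=\mu(\beta,\gamma)$ be the unique positive solution of $$\frac{1+\beta\mu}{2}=\frac{1-2^{\gamma-1-\mu}}{1-2^{\gamma-1}}.$$ Then for every $\beta>\beta_*$ there exists a function $g:(0,\infty)\to\mathbb{R}$ satisfying $$\beta x^2 g(x)=\int_{x/2}^{x}s^{2+\gamma}g^2(s)\,ds+(1-\gamma)(\beta-\beta_* )\int_0^x s\,g(s)\,ds\qquad\text{for all }x>0,$$ such that: (i) there is a constant $c>0$ with $$g(x)=x^{-(1+\gamma)}\Big(\frac{1}{1-\theta}-c\,x^{\mu}+o\big(x^{\mu}\big)\Big)\qquad\text{as }x\to0;$$ (ii) the function $x\mapsto x^{1+\gamma}g(x)$ is monotonically decreasing on $(0,\infty)$; (iii) there is a constant $d>0$ with $$g(x)\sim\frac{d}{x^{1+\gamma+1/\beta}}\qquad\text{as }x\to\infty.$$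
   Context: The equation is the integrated form of the self-similar profile equation for Smoluchowski's coagulation equation with diagonal kernel $K(\xi,\eta)=\delta_{(\xi-\eta)}\xi^{1+\gamma}$ of homogeneity $\gamma<1$. With the ansatz $f(\xi,t)=t^{-(1+(1+\gamma)\beta)}g(\xi/t^{\beta})$, the profile $g$ satisfies $$-\big(1+(1+\gamma)\beta\big)g(x)-\beta x g'(x)=\frac14\Big(\frac x2\Big)^{1+\gamma}g^2\Big(\frac x2\Big)-x^{1+\gamma}g^2(x).$$ Integrating this equation after multiplication by $x$ gives the integral equation in the claim. It is implicitly assumed that $x g(x)$ and $x^{2+\gamma}g^2(x)$ are integrable at zero and that $\lim_{x\to0}x^2g(x)=0$; these properties are implied by the behavior as $x\to0$ in (i). The notation $g(x)\sim\phi(x)$ as $x\to\infty$ means $g(x)/\phi(x)\to1$. *)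

(* Defs.v *)
From Stdlib Require Import Reals.
From Coquelicot Require Import Coquelicot.
Open Scope R_scope.

(* Functions on (0,oo) are represented by total functions R -> R of which only
   the values at positive arguments are ever used.  Real powers are [Rpower],
   which is the usual power for a positive base. *)

Definition beta_star (gamma : R) : R := 1 / (1 - gamma).

Definition theta (gamma : R) : R := Rpower 2 (gamma - 1).

Definition is_mu (gamma beta mu : R) : Prop :=
  0 < mu /\
  (1 + beta * mu) / 2 =
    (1 - Rpower 2 (gamma - 1 - mu)) / (1 - Rpower 2 (gamma - 1)).

(* Integrals over (0,x) are improper at 0, i.e. limits of the Riemann integrals
   over [a,x] as a -> 0+.  As [RInt] and [RInt_gen] are total, the implicit
   assumptions that x g and x^(2+gamma) g^2 are integrable at zero and that
   x^2 g -> 0 are part of the notion of solution; integrability of the second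
   one on (0,x) contains its Riemann integrability on [x/2,x]. *)
Definition profile_solution (gamma beta : R) (g : R -> R) : Prop :=
  (forall x : R, 0 < x ->
     ex_RInt_gen (fun s => s * g s) (at_right 0) (at_point x)) /\
  (forall x : R, 0 < x ->
     ex_RInt_gen (fun s => Rpower s (2 + gamma) * g s ^ 2)
       (at_right 0) (at_point x)) /\
  filterlim (fun x => x ^ 2 * g x) (at_right 0) (locally 0) /\
  (forall x : R, 0 < x ->
     beta * x ^ 2 * g x =
       RInt (fun s => Rpower s (2 + gamma) * g s ^ 2) (x / 2) x
       + (1 - gamma) * (beta - beta_star gamma)
         * RInt_gen (fun s => s * g s) (at_right 0) (at_point x)).

(* [is_domin F f r] is Coquelicot's  r = o(f)  along F. *)
Definition expansion_at_zero (gamma mu c : R) (g : R -> R) : Prop :=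
  exists r : R -> R,
    is_domin (at_right 0) (fun x => Rpower x mu) r /\
    forall x : R, 0 < x ->
      g x = Rpower x (- (1 + gamma))
            * (1 / (1 - theta gamma) - c * Rpower x mu + r x).

Definition decreasing_on_positives (h : R -> R) : Prop :=
  forall x y : R, 0 < x -> x < y -> h y < h x.

Definition asymp_at_infty (g phi : R -> R) : Prop :=
  is_lim (fun x => g x / phi x) p_infty 1.

(* Main.v *)
Require Import Defs.
From Stdlib Require Import Reals Lra.
From Coquelicot Require Import Coquelicot.
Open Scope R_scope.

(* In the variable [y = x^(1-gamma)], and with [k y = x^(1+gamma) g x], the
   integral equation becomes the fixed point equation
     k y = a int_theta^1 k(y r)^2 dr + (1-a) int_0^1 k(y r) dr,
   where [a = beta_star / beta].  The right-hand side is monotone in [k >= 0],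
   commutes with dilations, and fixes the constant [h = 1/(1-theta)].  Linearized
   at [h] it multiplies [y^nu] by a factor that is 1 at [nu = m = mu/(1-gamma)]
   and less than 1 at [nu = 2m]; hence on functions with values in [0,h] it is a
   contraction for the norm [sup |k y| / y^(2m)], and iterating it from
   [h^2/(h + y^m) = h - y^m + O(y^(2m))] gives a global solution with that
   expansion at 0.  Monotonicity and dilation invariance make it strictly
   decreasing.  At infinity, [y k' = a (k^2 - k - theta k(theta y)^2)] gives
   first an algebraic decay rate for [k] and then the convergence of
   [a ln y + ln (k y)]. *)

(** * Integrals with a dilated argument *)

Lemma continuous_ex_RInt (f : R -> R) (a b : R) :
  (forall x, continuous f x) -> ex_RInt f a b.
Proof. intros Hf. apply (ex_RInt_continuous f). intros z _. apply Hf. Qed.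

Lemma continuous_scaled (f : R -> R) (y : R) :
  (forall x, continuous f x) -> forall r, continuous (fun r => f (y * r)) r.
Proof.
  intros Hf r. apply (continuous_comp (fun r => y * r) f).
  - apply (continuous_mult (fun _ => y) (fun r => r)).
    + apply continuous_const.
    + apply continuous_id.
  - apply Hf.
Qed.

Lemma continuous_square (f : R -> R) :
  (forall x, continuous f x) -> forall x, continuous (fun x => f x ^ 2) x.
Proof.
  intros Hf x.
  apply (continuous_ext (fun x => f x * f x)).
  - intros z. simpl. ring.
  - apply (continuous_mult f f); apply Hf.
Qed.

(** For [|z - y| < 1] and [r] in [[p,q]], a subset of [[0,1]], both [y r] and [z r] lie in
    [[-(|y|+1), |y|+1]], where [f] is uniformly continuous. *)
Lemma continuous_RInt_scaled (f : R -> R) (p q : R) :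
  0 <= p <= q -> q <= 1 -> (forall x, continuous f x) ->
  forall y, continuous (fun y => RInt (fun r => f (y * r)) p q) y.
Proof.
  intros Hpq Hq Hf y.
  apply filterlim_locally. intros eps.
  destruct (unifcont_normed_1d f (- (Rabs y + 1)) (Rabs y + 1)
              (fun x _ => Hf x) (pos_div_2 eps)) as [d Hd].
  assert (Hm : 0 < Rmin d 1) by (apply Rmin_case; [apply d | lra]).
  exists (mkposreal _ Hm). intros z Hz.
  assert (Hzy : Rabs (z - y) < Rmin d 1) by exact Hz.
  assert (Hz1 := Rlt_le_trans _ _ _ Hzy (Rmin_r d 1)).
  assert (Hz2 := Rlt_le_trans _ _ _ Hzy (Rmin_l d 1)).
  change (Rabs (RInt (fun r => f (z * r)) p q - RInt (fun r => f (y * r)) p q) < eps).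
  assert (Ez := continuous_ex_RInt _ p q (continuous_scaled f z Hf)).
  assert (Ey := continuous_ex_RInt _ p q (continuous_scaled f y Hf)).
  assert (E : RInt (fun r => minus (f (z * r)) (f (y * r))) p q
              = RInt (fun r => f (z * r)) p q - RInt (fun r => f (y * r)) p q)
    by exact (RInt_minus _ _ p q Ez Ey).
  rewrite <- E.
  assert (B : Rabs (RInt (fun r => minus (f (z * r)) (f (y * r))) p q)
              <= (q - p) * (eps / 2)).
  { apply abs_RInt_le_const.
    - lra.
    - apply (ex_RInt_minus (fun r => f (z * r)) (fun r => f (y * r)) p q Ez Ey).
    - intros t Ht. left.
      assert (Hr : forall w, Rabs w <= Rabs y + 1 ->
                - (Rabs y + 1) <= w * t <= Rabs y + 1).
      { intros w Hw. apply Rabs_le_between. rewrite Rabs_mult.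
        rewrite (Rabs_pos_eq t) by lra.
        assert (0 <= Rabs w) by apply Rabs_pos. nra. }
      apply (Hd (y * t) (z * t)).
      + apply Hr. lra.
      + apply Hr. replace z with (y + (z - y)) by ring.
        apply Rle_trans with (1 := Rabs_triang _ _). lra.
      + change (Rabs (z * t - y * t) < d).
        replace (z * t - y * t) with ((z - y) * t) by ring.
        rewrite Rabs_mult, (Rabs_pos_eq t) by lra.
        assert (0 <= Rabs (z - y)) by apply Rabs_pos. nra. }
  assert (0 < eps) by apply eps. nra.
Qed.

(** Keeping the factor [y] on the left avoids a division, so [y = 0] and negative [y] are
    included. *)
Lemma RInt_scaled (f : R -> R) (y p q : R) :
  (forall x, continuous f x) ->
  y * RInt (fun r => f (y * r)) p q = RInt f (y * p) (y * q).
Proof.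
  intros Hf.
  assert (E : ex_RInt f (y * p + 0) (y * q + 0)) by now apply continuous_ex_RInt.
  assert (H := RInt_comp_lin f y 0 p q E).
  rewrite !Rplus_0_r in H. rewrite <- H.
  symmetry. etransitivity.
  - apply RInt_ext. intros x _. rewrite Rplus_0_r. reflexivity.
  - apply (RInt_scal (fun r => f (y * r)) p q y).
    apply continuous_ex_RInt. now apply continuous_scaled.
Qed.

(** Tailored to the expansion at 0, which decides strict signs only near 0. *)
Lemma RInt_pos_of_pos_near_0 (f : R -> R) (d : R) :
  (forall x, continuous f x) -> (forall x, 0 <= x -> 0 <= f x) ->
  0 < d -> (forall x, 0 < x < d -> 0 < f x) -> 0 < RInt f 0 1.
Proof.
  intros Hf Hpos Hd Hnear.
  set (e := Rmin d 1).
  assert (He : 0 < e) by (apply Rmin_case; lra).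
  assert (He1 : e <= 1) by apply Rmin_r.
  assert (Hed : e <= d) by apply Rmin_l.
  rewrite <- (RInt_Chasles f 0 e 1); try now apply continuous_ex_RInt.
  apply Rplus_lt_le_0_compat.
  - apply RInt_gt_0; auto. intros x Hx. apply Hnear. lra.
  - apply RInt_ge_0; auto.
    + now apply continuous_ex_RInt.
    + intros x Hx. apply Hpos. lra.
Qed.

(** * Powers on the whole line and their integrals *)

(* Powers extended by 0 to the nonpositive half line: unlike
   [Rpower], which takes the value 1 at 0, this is continuous on R. *)
Definition ppow (m y : R) : R := if Rle_dec y 0 then 0 else Rpower y m.

Lemma ppow_npos (m y : R) : y <= 0 -> ppow m y = 0.
Proof. intros H. unfold ppow. now destruct (Rle_dec y 0). Qed.

Lemma ppow_pos (m y : R) : 0 < y -> ppow m y = Rpower y m.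
Proof. intros H. unfold ppow. destruct (Rle_dec y 0); [lra | easy]. Qed.

Lemma ppow_ge_0 (m y : R) : 0 <= ppow m y.
Proof.
  unfold ppow. destruct (Rle_dec y 0); [lra |].
  left. apply exp_pos.
Qed.

Lemma ppow_1 (m : R) : ppow m 1 = 1.
Proof.
  rewrite ppow_pos by lra. unfold Rpower. now rewrite ln_1, Rmult_0_r, exp_0.
Qed.

Lemma ppow_mult (m x y : R) : 0 <= y ->
  ppow m (x * y) = ppow m x * ppow m y.
Proof.
  intros Hy.
  destruct (Rle_dec x 0) as [Hx|Hx].
  { rewrite (ppow_npos m (x * y)), (ppow_npos m x) by nra. ring. }
  destruct (Req_dec y 0) as [->|Hy0].
  { rewrite Rmult_0_r, (ppow_npos m 0) by lra. ring. }
  rewrite !ppow_pos; try nra.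
  symmetry. apply Rpower_mult_distr; lra.
Qed.

Lemma ppow_double (m y : R) : ppow (2 * m) y = ppow m y ^ 2.
Proof.
  unfold ppow. destruct (Rle_dec y 0).
  - ring.
  - replace (2 * m) with (m + m) by ring. rewrite Rpower_plus. ring.
Qed.

Lemma ppow_lt (m x y : R) : 0 < m -> 0 <= x < y -> ppow m x < ppow m y.
Proof.
  intros Hm H. rewrite (ppow_pos m y) by lra.
  destruct (Req_dec x 0) as [->|Hx].
  - rewrite ppow_npos by lra. apply exp_pos.
  - rewrite ppow_pos by lra. apply exp_increasing.
    apply Rmult_lt_compat_l; [lra |]. apply ln_increasing; lra.
Qed.

Lemma ppow_le (m x y : R) : 0 < m -> x <= y -> ppow m x <= ppow m y.
Proof.
  intros Hm H.
  destruct (Rle_dec x 0) as [Hx|Hx].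
  - rewrite ppow_npos by lra. apply ppow_ge_0.
  - destruct (Req_dec x y) as [->|]; [lra |].
    left. apply ppow_lt; lra.
Qed.

Lemma ppow_small (m e : R) : 0 < m -> 0 < e ->
  exists d, 0 < d /\ forall x, x < d -> ppow m x < e.
Proof.
  intros Hm He. exists (Rpower e (/ m)). split; [apply exp_pos |].
  intros x Hx. unfold ppow. destruct (Rle_dec x 0) as [|Hx0]; [lra |].
  replace e with (Rpower (Rpower e (/ m)) m).
  - apply exp_increasing. apply Rmult_lt_compat_l; [lra |].
    apply ln_increasing; lra.
  - rewrite Rpower_mult, Rinv_l by lra. now apply Rpower_1.
Qed.

Lemma is_derive_Rpower (m x : R) : 0 < x ->
  is_derive (fun x => Rpower x m) x (m * Rpower x (m - 1)).
Proof. intros Hx. apply is_derive_Reals. now apply derivable_pt_lim_power. Qed.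

Lemma continuous_ppow (m : R) : 0 < m -> forall x, continuous (ppow m) x.
Proof.
  intros Hm x.
  destruct (total_order_T x 0) as [[Hx| ->]|Hx].
  - apply (continuous_ext_loc _ (fun _ => 0)).
    + apply (filter_imp (fun z => z < 0)).
      * intros z Hz. now rewrite ppow_npos by lra.
      * now apply open_lt.
    + apply continuous_const.
  - apply filterlim_locally. intros eps.
    destruct (ppow_small m eps Hm (cond_pos eps)) as [d [Hd Hs]].
    exists (mkposreal d Hd). intros z Hz.
    change (Rabs (z - 0) < d) in Hz.
    change (Rabs (ppow m z - ppow m 0) < eps).
    rewrite (ppow_npos m 0), Rminus_0_r by lra.
    rewrite Rabs_pos_eq by apply ppow_ge_0. apply Hs.
    apply Rabs_def2 in Hz. lra.
  - apply (continuous_ext_loc _ (fun z => Rpower z m)).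
    + apply (filter_imp (fun z => 0 < z)).
      * intros z Hz. now rewrite ppow_pos by lra.
      * now apply open_gt.
    + apply (@ex_derive_continuous R_AbsRing R_NormedModule). eexists. now apply is_derive_Rpower.
Qed.

(** For [m < 1] the power itself is not differentiable at 0, but its product with [x] is. This gives
    an antiderivative of the power that is valid across 0, so the integrals from 0 are proper. *)
Lemma is_derive_id_mul_ppow (m : R) : 0 < m ->
  forall x, is_derive (fun x => x * ppow m x) x ((m + 1) * ppow m x).
Proof.
  intros Hm x.
  destruct (total_order_T x 0) as [[Hx| ->]|Hx].
  - rewrite ppow_npos by lra.
    apply (is_derive_ext_loc (fun _ => 0)).
    + apply (filter_imp (fun z => z < 0)).
      * intros z Hz. rewrite ppow_npos by lra. symmetry. apply Rmult_0_r.
      * now apply open_lt.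
    + rewrite Rmult_0_r. apply @is_derive_const.
  - rewrite (ppow_npos m 0), Rmult_0_r by lra.
    apply is_derive_Reals. intros eps Heps.
    destruct (ppow_small m eps Hm Heps) as [d [Hd Hs]].
    exists (mkposreal d Hd). intros h Hh0 Hh. simpl in Hh.
    rewrite (ppow_npos m 0), Rplus_0_l by lra.
    replace ((h * ppow m h - 0 * 0) / h - 0) with (ppow m h) by now field.
    rewrite Rabs_pos_eq by apply ppow_ge_0. apply Hs.
    apply Rabs_def2 in Hh. lra.
  - apply (is_derive_ext_loc (fun z => Rpower z (m + 1))).
    + apply (filter_imp (fun z => 0 < z)).
      * intros z Hz. rewrite ppow_pos by lra.
        rewrite Rpower_plus, (Rpower_1 z) by lra. apply Rmult_comm.
      * now apply open_gt.
    + rewrite ppow_pos by lra.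
      assert (H := is_derive_Rpower (m + 1) x Hx).
      now replace (m + 1 - 1) with m in H by ring.
Qed.

(** Powers are eigenfunctions of averaging over dilations; the eigenvalues for [p = theta] and
    [p = 0] make up [mode_factor]. *)
Lemma RInt_ppow_scaled (m y p : R) : 0 < m -> 0 <= p <= 1 ->
  RInt (fun r => ppow m (y * r)) p 1
  = ppow m y * ((1 - p * ppow m p) / (m + 1)).
Proof.
  intros Hm Hp.
  apply is_RInt_unique.
  apply (is_RInt_ext (fun r => ppow m y / (m + 1) * ((m + 1) * ppow m r))).
  { intros r Hr. rewrite Rmin_left in Hr by lra.
    rewrite ppow_mult by lra. simpl. field. lra. }
  replace (ppow m y * ((1 - p * ppow m p) / (m + 1)))
    with (scal (ppow m y / (m + 1)) (minus (1 * ppow m 1) (p * ppow m p))).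
  - apply (is_RInt_scal (fun r => (m + 1) * ppow m r)).
    apply (is_RInt_derive (fun r => r * ppow m r)).
    + intros r _. now apply is_derive_id_mul_ppow.
    + intros r _. apply (continuous_mult (fun _ => m + 1) (ppow m)).
      * apply continuous_const.
      * now apply continuous_ppow.
  - rewrite ppow_1.
    change (ppow m y / (m + 1) * (1 * 1 - p * ppow m p)
            = ppow m y * ((1 - p * ppow m p) / (m + 1))).
    field. lra.
Qed.

(** * Monotonicity and contraction of the fixed point map *)

Lemma RInt_dist (f g w : R -> R) (p q : R) : p <= q ->
  (forall x, continuous f x) -> (forall x, continuous g x) ->
  (forall x, continuous w x) ->
  (forall x, p <= x <= q -> Rabs (f x - g x) <= w x) ->
  Rabs (RInt f p q - RInt g p q) <= RInt w p q.
Proof.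
  intros Hpq Hf Hg Hw H.
  assert (E := RInt_minus f g p q (continuous_ex_RInt f p q Hf)
                 (continuous_ex_RInt g p q Hg)).
  change (RInt (fun x => f x - g x) p q = RInt f p q - RInt g p q) in E.
  rewrite <- E.
  assert (C : forall x, continuous (fun x => f x - g x) x)
    by (intros x; now apply (continuous_minus f g)).
  apply Rle_trans with (RInt (fun x => Rabs (f x - g x)) p q).
  - apply abs_RInt_le; [easy | now apply continuous_ex_RInt].
  - apply RInt_le; auto.
    + apply continuous_ex_RInt. intros x.
      apply (continuous_comp (fun x => f x - g x) Rabs); [apply C |].
      apply continuous_Rabs.
    + now apply continuous_ex_RInt.
    + intros x Hx. apply H. lra.
Qed.

(* [r] is [(s/x)^(1-gamma)] in the two integrals of the profile equation. *)
Definition profile_map (theta a : R) (k : R -> R) (y : R) : R :=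
  a * RInt (fun r => k (y * r) ^ 2) theta 1
  + (1 - a) * RInt (fun r => k (y * r)) 0 1.

(** A class that the map preserves and that survives the limit of the iteration: the bound [H] makes
    squaring [2 H]-Lipschitz, and monotonicity is used again for the tail. *)
Definition admissible (H : R) (k : R -> R) : Prop :=
  (forall x, continuous k x) /\ (forall x, 0 <= k x <= H) /\
  (forall x y, x <= y -> k y <= k x).

Lemma continuous_scaled_square (k : R -> R) (y : R) :
  (forall x, continuous k x) -> forall r, continuous (fun r => k (y * r) ^ 2) r.
Proof.
  intros Hk r.
  apply (continuous_scaled (fun x => k x ^ 2)). now apply continuous_square.
Qed.

Lemma profile_map_const (theta a y : R) : theta < 1 ->
  profile_map theta a (fun _ => / (1 - theta)) y = / (1 - theta).
Proof.
  intros Ht. unfold profile_map. rewrite !RInt_const.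
  change (a * ((1 - theta) * (/ (1 - theta)) ^ 2)
          + (1 - a) * ((1 - 0) * / (1 - theta)) = / (1 - theta)).
  field. lra.
Qed.

(** Two functions and two points at once: [x = y] gives monotonicity of the map, [u = v] gives
    monotonicity of the image function. *)
Lemma profile_map_le (theta a : R) (u v : R -> R) (x y : R) :
  0 < theta < 1 -> 0 < a < 1 ->
  (forall z, continuous u z) -> (forall z, continuous v z) ->
  (forall r, 0 <= r <= 1 -> 0 <= u (x * r) <= v (y * r)) ->
  profile_map theta a u x <= profile_map theta a v y.
Proof.
  intros Ht Ha Hu Hv H. unfold profile_map.
  apply Rplus_le_compat; apply Rmult_le_compat_l; try lra; apply RInt_le; try lra;
    try (apply continuous_ex_RInt; (now apply continuous_scaled) ||
                                   (now apply continuous_scaled_square));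
    intros r Hr.
  - apply pow_incr. apply H. lra.
  - apply H. lra.
Qed.

Lemma admissible_profile_map (theta a : R) (k : R -> R) :
  0 < theta < 1 -> 0 < a < 1 ->
  admissible (/ (1 - theta)) k ->
  admissible (/ (1 - theta)) (profile_map theta a k).
Proof.
  intros Ht Ha [Hc [Hb Hd]]. repeat split.
  - intros y. unfold profile_map.
    apply (continuous_plus
             (fun y => a * RInt (fun r => k (y * r) ^ 2) theta 1)
             (fun y => (1 - a) * RInt (fun r => k (y * r)) 0 1)).
    + apply (continuous_mult (fun _ => a)); [apply continuous_const |].
      apply (continuous_RInt_scaled (fun x => k x ^ 2)); try lra.
      now apply continuous_square.
    + apply (continuous_mult (fun _ => 1 - a)); [apply continuous_const |].
      apply (continuous_RInt_scaled k); try lra; auto.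
  - unfold profile_map. apply Rplus_le_le_0_compat; apply Rmult_le_pos; try lra;
      apply RInt_ge_0; try lra;
      try (apply continuous_ex_RInt; (now apply continuous_scaled) ||
                                     (now apply continuous_scaled_square));
      intros r Hr.
    + apply pow2_ge_0.
    + apply Hb.
  (* The upper bound is comparison with the constant fixed point. *)
  - rewrite <- (profile_map_const theta a x) by lra.
    apply profile_map_le; auto.
    intros z. apply continuous_const.
  - intros x y Hxy. apply profile_map_le; auto.
    intros r Hr. split; [apply Hb |]. apply Hd. nra.
Qed.

(* [profile_map] linearized at the constant solution multiplies [ppow nu] by
   this factor. *)
Definition mode_factor (theta a nu : R) : R :=
  (2 * / (1 - theta) * a * (1 - theta * ppow nu theta) + (1 - a)) / (nu + 1).

Lemma mode_factor_ge_0 (theta a nu : R) :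
  0 < theta < 1 -> 0 < a < 1 -> 0 < nu -> 0 <= mode_factor theta a nu.
Proof.
  intros Ht Ha Hn. unfold mode_factor.
  assert (P := ppow_ge_0 nu theta).
  assert (Q : ppow nu theta < 1) by (rewrite <- (ppow_1 nu); apply ppow_lt; lra).
  assert (0 < / (1 - theta)) by (apply Rinv_0_lt_compat; lra).
  apply Rle_mult_inv_pos; [| lra].
  apply Rplus_le_le_0_compat; [| lra].
  apply Rmult_le_pos; nra.
Qed.

(* Convexity in [nu]: the factor is 1 at [nu = m] and [1 + a] at [nu = 0]. *)
Lemma mode_factor_double_lt_1 (theta a m : R) :
  0 < theta < 1 -> 0 < a < 1 -> 0 < m ->
  mode_factor theta a m = 1 -> mode_factor theta a (2 * m) < 1.
Proof.
  intros Ht Ha Hm E. unfold mode_factor in *.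
  rewrite ppow_double.
  set (t := ppow m theta) in *. set (h := / (1 - theta)) in *.
  assert (Hh : h * (1 - theta) = 1) by (unfold h; field; lra).
  assert (0 < h) by (apply Rinv_0_lt_compat; lra).
  apply (f_equal (fun z => z * (m + 1))) in E.
  unfold Rdiv in E. rewrite Rmult_assoc, Rinv_l, Rmult_1_r, Rmult_1_l in E by lra.
  apply (Rmult_lt_reg_r (2 * m + 1)); [lra |].
  unfold Rdiv. rewrite Rmult_assoc, Rinv_l, Rmult_1_r, Rmult_1_l by lra.
  (* By [E], the right side minus the left side equals [2 * (h * a * theta * (1 - t) ^ 2) + a],
     which is positive. *)
  assert (S : 0 <= h * a * theta * (1 - t) ^ 2).
  { apply Rmult_le_pos; [| apply pow2_ge_0].
    apply Rmult_le_pos; [apply Rmult_le_pos |]; lra. }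
  assert (S2 : a * (h * (1 - theta)) = a) by (rewrite Hh; ring).
  nra.
Qed.

Lemma RInt_scal_R (f : R -> R) (c p q : R) : (forall x, continuous f x) ->
  RInt (fun r => c * f r) p q = c * RInt f p q.
Proof.
  intros Hf. apply (RInt_scal f p q c). now apply continuous_ex_RInt.
Qed.

Lemma continuous_scal_R (f : R -> R) (c : R) :
  (forall x, continuous f x) -> forall x, continuous (fun r => c * f r) x.
Proof.
  intros Hf x. apply (continuous_mult (fun _ => c) f); auto.
  apply continuous_const.
Qed.

(** On values in [[0,h]] the square is [2 h]-Lipschitz, which is exactly its linearization at [h];
    integrating the weight then yields the linearized factor with no loss. *)
Lemma profile_map_contracts (theta a nu M : R) (u v : R -> R) :
  0 < theta < 1 -> 0 < a < 1 -> 0 < nu ->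
  admissible (/ (1 - theta)) u -> admissible (/ (1 - theta)) v ->
  (forall x, Rabs (u x - v x) <= M * ppow nu x) ->
  forall y, Rabs (profile_map theta a u y - profile_map theta a v y)
            <= M * mode_factor theta a nu * ppow nu y.
Proof.
  intros Ht Ha Hn [Hu [Bu _]] [Hv [Bv _]] H y. unfold profile_map.
  set (h := / (1 - theta)) in *.
  assert (Cp := continuous_scaled _ y (continuous_ppow nu Hn)).
  assert (A1 := RInt_dist (fun r => u (y * r) ^ 2) (fun r => v (y * r) ^ 2)
           (fun r => (2 * h * M) * ppow nu (y * r)) theta 1).
  assert (A2 := RInt_dist (fun r => u (y * r)) (fun r => v (y * r))
           (fun r => M * ppow nu (y * r)) 0 1).
  rewrite RInt_scal_R, RInt_ppow_scaled in A1 by (auto; lra).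
  rewrite RInt_scal_R, RInt_ppow_scaled in A2 by (auto; lra).
  rewrite Rmult_0_l, Rminus_0_r in A2.
  specialize (A1 ltac:(lra) (continuous_scaled_square u y Hu)
    (continuous_scaled_square v y Hv) (continuous_scal_R _ _ Cp)).
  specialize (A2 ltac:(lra) (continuous_scaled u y Hu)
    (continuous_scaled v y Hv) (continuous_scal_R _ _ Cp)).
  assert (B1 : forall r, theta <= r <= 1 ->
     Rabs (u (y * r) ^ 2 - v (y * r) ^ 2) <= (2 * h * M) * ppow nu (y * r)).
  { intros r _. set (z := y * r).
    replace (u z ^ 2 - v z ^ 2) with ((u z + v z) * (u z - v z)) by ring.
    rewrite Rabs_mult, Rabs_pos_eq by (generalize (Bu z) (Bv z); lra).
    specialize (H z). specialize (Bu z). specialize (Bv z).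
    assert (0 <= Rabs (u z - v z)) by apply Rabs_pos. nra. }
  specialize (A1 B1). specialize (A2 (fun r _ => H (y * r))).
  match goal with |- Rabs (a * ?p + (1 - a) * ?q - (a * ?r + (1 - a) * ?s)) <= _ =>
    replace (a * p + (1 - a) * q - (a * r + (1 - a) * s))
      with (a * (p - r) + (1 - a) * (q - s)) by ring end.
  apply Rle_trans with (1 := Rabs_triang _ _).
  rewrite !Rabs_mult, (Rabs_pos_eq a), (Rabs_pos_eq (1 - a)) by lra.
  apply Rle_trans with (1 := Rplus_le_compat _ _ _ _
    (Rmult_le_compat_l a _ _ ltac:(lra) A1)
    (Rmult_le_compat_l (1 - a) _ _ ltac:(lra) A2)).
  right. unfold mode_factor. fold h. field. lra.
Qed.

(** * Limits of geometrically convergent iterations *)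

Lemma geometric_limit (u : nat -> R) (c q : R) : 0 <= q < 1 ->
  (forall n, Rabs (u (S n) - u n) <= c * q ^ n) ->
  forall n, Rabs (real (Lim_seq u) - u n) <= c / (1 - q) * q ^ n.
Proof.
  intros Hq H.
  assert (Hc : 0 <= c).
  { specialize (H O). simpl in H. generalize (Rabs_pos (u 1%nat - u O)). lra. }
  (* Telescoping, with the exact partial geometric sum so that the induction closes. *)
  assert (B : forall n p, Rabs (u (n + p)%nat - u n) <= c / (1 - q) * (q ^ n - q ^ (n + p))).
  { intros n p. induction p as [|p IH].
    - rewrite Nat.add_0_r, !Rminus_diag, Rabs_R0. lra.
    - replace (n + S p)%nat with (S (n + p)) by apply plus_n_Sm.
      replace (u (S (n + p)) - u n)
        with ((u (S (n + p)) - u (n + p)%nat) + (u (n + p)%nat - u n)) by ring.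
      apply Rle_trans with (1 := Rabs_triang _ _).
      apply Rle_trans with (1 := Rplus_le_compat _ _ _ _ (H _) IH).
      right. simpl. field. lra. }
  assert (B' : forall n p, (n <= p)%nat -> Rabs (u p - u n) <= c / (1 - q) * q ^ n).
  { intros n p Hp. replace p with (n + (p - n))%nat by
      (rewrite Nat.add_comm; now apply Nat.sub_add).
    apply Rle_trans with (1 := B _ _).
    apply Rmult_le_compat_l; [apply Rle_mult_inv_pos; lra |].
    assert (0 <= q ^ (n + (p - n))) by (apply pow_le; lra). lra. }
  assert (C : ex_finite_lim_seq u).
  { apply ex_lim_seq_cauchy_corr. intros eps.
    assert (Hk : 0 < c / (1 - q) + 1).
    { assert (0 <= c / (1 - q)) by (apply Rle_mult_inv_pos; lra). lra. }
    destruct (pow_lt_1_zero q ltac:(rewrite Rabs_pos_eq; lra)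
                (eps / (2 * (c / (1 - q) + 1)))) as [N HN].
    { apply Rdiv_lt_0_compat; [apply eps | lra]. }
    exists N. intros n p Hn Hp.
    specialize (HN N (le_n N)). rewrite Rabs_pos_eq in HN by (apply pow_le; lra).
    replace (u n - u p) with ((u n - u N) - (u p - u N)) by ring.
    apply Rle_lt_trans with (1 := Rabs_triang _ _). rewrite Rabs_Ropp.
    assert (B1 := B' N n Hn). assert (B2 := B' N p Hp).
    assert (Q : 0 <= q ^ N) by (apply pow_le; lra).
    apply (Rmult_lt_compat_r (2 * (c / (1 - q) + 1))) in HN; [| lra].
    unfold Rdiv at 2 in HN. rewrite Rmult_assoc, Rinv_l in HN by lra. nra. }
  destruct C as [l Hl]. intros n.
  rewrite (is_lim_seq_unique u l Hl). simpl.
  apply (is_lim_seq_le_loc (fun p => Rabs (u p - u n)) (fun _ => c / (1 - q) * q ^ n)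
           (Rabs (l - u n)) (c / (1 - q) * q ^ n)).
  - exists n. intros p Hp. now apply B'.
  - apply (is_lim_seq_abs _ (l - u n)).
    apply is_lim_seq_minus'; [easy | apply is_lim_seq_const].
  - apply is_lim_seq_const.
Qed.

Lemma geometric_limit_fun (u : nat -> R -> R) (W : R -> R) (C q : R) :
  0 <= q < 1 ->
  (forall n y, Rabs (u (S n) y - u n y) <= C * q ^ n * W y) ->
  exists k, forall n y, Rabs (k y - u n y) <= C / (1 - q) * q ^ n * W y.
Proof.
  intros Hq H.
  exists (fun y => real (Lim_seq (fun n => u n y))). intros n y.
  apply Rle_trans with ((C * W y) / (1 - q) * q ^ n).
  - apply (geometric_limit (fun n => u n y)); [easy |].
    intros p. rewrite Rmult_assoc, (Rmult_comm (W y)), <- Rmult_assoc. apply H.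
  - right. field. lra.
Qed.

(** Passes properties of the iterates to their limit: the defect of the limit is bounded by [c q^n]
    for every [n]. *)
Lemma le_of_geometric (x c q : R) : 0 <= q < 1 ->
  (forall n : nat, x <= c * q ^ n) -> x <= 0.
Proof.
  intros Hq H.
  apply (is_lim_seq_le (fun _ => x) (fun n => c * q ^ n) x 0 H).
  - apply is_lim_seq_const.
  - replace (Finite 0) with (Rbar_mult c 0) by (simpl; now rewrite Rmult_0_r).
    apply is_lim_seq_scal_l. apply is_lim_seq_geom. rewrite Rabs_pos_eq; lra.
Qed.

(** The weight is nondecreasing, so on the unit ball around [y] it is at most its value at [y + 1].
    Convergence is thus locally uniform and preserves continuity; the order properties pass
    pointwise. *)
Lemma admissible_limit (u : nat -> R -> R) (k : R -> R) (h m C q : R) :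
  0 < m -> 0 <= q < 1 -> 0 <= C ->
  (forall n, admissible h (u n)) ->
  (forall n y, Rabs (k y - u n y) <= C * q ^ n * ppow m y) ->
  admissible h k.
Proof.
  intros Hm Hq HC Hu Hk.
  assert (Hk' : forall n y, - (C * ppow m y * q ^ n) <= k y - u n y <= C * ppow m y * q ^ n).
  { intros n y. apply Rabs_le_between. specialize (Hk n y). nra. }
  repeat split.
  - intros y. apply continuity_pt_filterlim.
    apply (CVU_continuity u k y (mkposreal 1 Rlt_0_1)).
    + intros eps Heps.
      assert (0 <= ppow m (y + 1)) by apply ppow_ge_0.
      assert (HB : 0 < C * ppow m (y + 1) + 1) by nra.
      destruct (pow_lt_1_zero q ltac:(rewrite Rabs_pos_eq; lra)
                  (eps / (C * ppow m (y + 1) + 1))) as [N HN].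
      { now apply Rdiv_lt_0_compat. }
      exists N. intros n z Hn Hz. unfold Boule in Hz. simpl in Hz.
      apply Rle_lt_trans with (1 := Hk n z).
      specialize (HN n Hn). rewrite Rabs_pos_eq in HN by (apply pow_le; lra).
      apply (Rmult_lt_compat_r (C * ppow m (y + 1) + 1)) in HN; [| lra].
      unfold Rdiv in HN. rewrite Rmult_assoc, Rinv_l, Rmult_1_r in HN by lra.
      apply Rle_lt_trans with (2 := HN).
      assert (Q : 0 <= q ^ n) by (apply pow_le; lra).
      assert (ppow m z <= ppow m (y + 1)).
      { apply ppow_le; [easy |]. apply Rabs_def2 in Hz. lra. }
      assert (C * ppow m z <= C * ppow m (y + 1)) by now apply Rmult_le_compat_l.
      nra.
    + intros n z _. apply continuity_pt_filterlim. apply Hu.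
    + unfold Boule. rewrite Rminus_diag, Rabs_R0. simpl. lra.
  - apply Ropp_le_cancel. rewrite Ropp_0.
    apply (le_of_geometric _ (C * ppow m x) q Hq). intros n.
    destruct (Hu n) as [_ [B _]]. specialize (B x). specialize (Hk' n x). lra.
  - apply Rminus_le. apply (le_of_geometric _ (C * ppow m x) q Hq). intros n.
    destruct (Hu n) as [_ [B _]]. specialize (B x). specialize (Hk' n x). lra.
  - intros x y Hxy. apply Rminus_le.
    apply (le_of_geometric _ (C * ppow m x + C * ppow m y) q Hq). intros n.
    destruct (Hu n) as [_ [_ D]]. specialize (D x y Hxy).
    generalize (Hk' n x) (Hk' n y). lra.
Qed.

(** * The starting function and the fixed point *)

Definition initial_profile (h m y : R) : R := h ^ 2 / (h + ppow m y).

(** This is the reason for the rational form: it agrees with [h - y^m] to first order at 0, but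
    stays positive for large [y]. *)
Lemma initial_profile_admissible (h m : R) : 0 < h -> 0 < m ->
  admissible h (initial_profile h m).
Proof.
  intros Hh Hm. unfold initial_profile. repeat split.
  - intros y. apply (continuous_mult (fun _ => h ^ 2) (fun y => / (h + ppow m y))).
    + apply continuous_const.
    + apply continuous_Rinv_comp.
      * apply (continuous_plus (fun _ => h) (ppow m)).
        -- apply continuous_const.
        -- now apply continuous_ppow.
      * generalize (ppow_ge_0 m y). lra.
  - generalize (ppow_ge_0 m x). intros P.
    apply Rle_mult_inv_pos; [apply pow2_ge_0 | lra].
  - generalize (ppow_ge_0 m x). intros P.
    apply Rle_div_l; [lra |]. nra.
  - intros x y Hxy. generalize (ppow_ge_0 m x) (ppow_le m x y Hm Hxy). intros P Q.
    apply Rmult_le_compat_l; [apply pow2_ge_0 |].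
    apply Rinv_le_contravar; lra.
Qed.

Lemma initial_profile_expansion (h m y : R) : 0 < h ->
  Rabs (initial_profile h m y - (h - ppow m y)) <= / h * ppow (2 * m) y.
Proof.
  intros Hh. unfold initial_profile. rewrite ppow_double.
  generalize (ppow_ge_0 m y). set (p := ppow m y). intros P.
  replace (h ^ 2 / (h + p) - (h - p)) with (/ (h + p) * p ^ 2) by (field; lra).
  rewrite Rabs_pos_eq.
  - apply Rmult_le_compat_r; [apply pow2_ge_0 |]. apply Rinv_le_contravar; lra.
  - apply Rmult_le_pos; [| apply pow2_ge_0].
    left. apply Rinv_0_lt_compat. lra.
Qed.

Lemma initial_profile_square_expansion (h m y : R) : 0 < h ->
  Rabs (initial_profile h m y ^ 2 - (h ^ 2 - 2 * h * ppow m y)) <= 3 * ppow (2 * m) y.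
Proof.
  intros Hh. unfold initial_profile. rewrite ppow_double.
  generalize (ppow_ge_0 m y). set (p := ppow m y). intros P.
  (* The constant 3 comes from [h (3 h + 2 p) <= 3 (h + p)^2]. *)
  replace ((h ^ 2 / (h + p)) ^ 2 - (h ^ 2 - 2 * h * p))
    with ((h * (3 * h + 2 * p)) / (h + p) ^ 2 * p ^ 2) by (field; lra).
  assert (0 < (h + p) ^ 2) by (apply pow_lt; lra).
  rewrite Rabs_pos_eq.
  - apply Rmult_le_compat_r; [apply pow2_ge_0 |]. apply Rle_div_l; [easy |]. nra.
  - apply Rmult_le_pos; [| apply pow2_ge_0].
    apply Rle_mult_inv_pos; [nra | easy].
Qed.

Lemma RInt_affine_ppow (h c m y p : R) : 0 < m -> 0 <= p <= 1 ->
  RInt (fun r => h - c * ppow m (y * r)) p 1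
  = h * (1 - p) - c * (ppow m y * ((1 - p * ppow m p) / (m + 1))).
Proof.
  intros Hm Hp.
  assert (Cp := continuous_scaled _ y (continuous_ppow m Hm)).
  rewrite <- RInt_ppow_scaled, <- RInt_scal_R by easy.
  assert (E := RInt_minus (fun _ => h) (fun r => c * ppow m (y * r)) p 1
    (ex_RInt_const _ _ _) (continuous_ex_RInt _ _ _ (continuous_scal_R _ c Cp))).
  rewrite RInt_const in E.
  change (RInt (fun r => h - c * ppow m (y * r)) p 1
    = (1 - p) * h - RInt (fun r => c * ppow m (y * r)) p 1) in E.
  rewrite E. simpl. ring.
Qed.

(** The terms of order 0 and [m] cancel because [h] is a fixed point and the factor at [m] is 1.
    What remains is of the order of the weight in which the map contracts. *)
Lemma initial_profile_map (theta a m : R) :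
  0 < theta < 1 -> 0 < a < 1 -> 0 < m -> mode_factor theta a m = 1 ->
  let k0 := initial_profile (/ (1 - theta)) m in
  exists C, 0 <= C /\
    forall y, Rabs (profile_map theta a k0 y - k0 y) <= C * ppow (2 * m) y.
Proof.
  intros Ht Ha Hm E k0. set (h := / (1 - theta)) in *.
  assert (Hh : 0 < h) by (apply Rinv_0_lt_compat; lra).
  assert (P := ppow_ge_0 (2 * m) theta).
  assert (Q : ppow (2 * m) theta < 1)
    by (rewrite <- (ppow_1 (2 * m)); apply ppow_lt; lra).
  assert (Hh' : 0 < / h) by (now apply Rinv_0_lt_compat).
  (* The integrated remainders of [k0 ^ 2] and [k0], plus the remainder of [k0] itself. *)
  exists (a * (3 * ((1 - theta * ppow (2 * m) theta) / (2 * m + 1)))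
          + (1 - a) * (/ h * (1 / (2 * m + 1))) + / h).
  split.
  { assert (0 <= (1 - theta * ppow (2 * m) theta) / (2 * m + 1))
      by (apply Rle_mult_inv_pos; nra).
    assert (0 <= 1 / (2 * m + 1)) by (apply Rle_mult_inv_pos; lra).
    repeat apply Rplus_le_le_0_compat; [| | lra];
      (apply Rmult_le_pos; [lra | apply Rmult_le_pos; lra]). }
  intros y. unfold profile_map.
  assert (Ck : forall x, continuous k0 x) by now apply initial_profile_admissible.
  assert (Cp := continuous_scaled _ y (continuous_ppow m Hm)).
  assert (Cp2 := continuous_scaled _ y (continuous_ppow (2 * m) ltac:(lra))).
  assert (Caff : forall c d x, continuous (fun r => d - c * ppow m (y * r)) x).
  { intros c d x. apply (continuous_minus (fun _ => d) (fun r => c * ppow m (y * r))).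
    - apply continuous_const.
    - now apply continuous_scal_R. }
  assert (A1 := RInt_dist (fun r => k0 (y * r) ^ 2)
    (fun r => h ^ 2 - 2 * h * ppow m (y * r))
    (fun r => 3 * ppow (2 * m) (y * r)) theta 1 ltac:(lra)
    (continuous_scaled_square k0 y Ck) (Caff (2 * h) (h ^ 2)) (continuous_scal_R _ _ Cp2)
    (fun r _ => initial_profile_square_expansion h m (y * r) Hh)).
  assert (A2 := RInt_dist (fun r => k0 (y * r))
    (fun r => h - 1 * ppow m (y * r))
    (fun r => / h * ppow (2 * m) (y * r)) 0 1 ltac:(lra)
    (continuous_scaled k0 y Ck) (Caff 1 h) (continuous_scal_R _ _ Cp2)).
  rewrite RInt_affine_ppow, RInt_scal_R, RInt_ppow_scaled in A1 by (auto; lra).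
  rewrite RInt_affine_ppow, RInt_scal_R, RInt_ppow_scaled in A2 by (auto; lra).
  rewrite !Rmult_0_l, !Rminus_0_r in A2.
  assert (A2' := A2 ltac:(intros r _; rewrite Rmult_1_l;
                          now apply initial_profile_expansion)).
  clear A2.
  assert (A3 := initial_profile_expansion h m y Hh).
  (* The affine part [h - y^m] is reproduced exactly by the linearized map. *)
  assert (Lin : h - ppow m y =
    a * (h ^ 2 * (1 - theta)
         - 2 * h * (ppow m y * ((1 - theta * ppow m theta) / (m + 1))))
    + (1 - a) * (h * 1 - 1 * (ppow m y * (1 / (m + 1))))).
  { transitivity (h - mode_factor theta a m * ppow m y); [rewrite E; ring |].
    unfold mode_factor. fold h.
    replace (h ^ 2 * (1 - theta)) with h by (unfold h; field; lra).
    field. lra. }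
  match goal with |- Rabs (a * ?p + (1 - a) * ?q - ?z) <= _ =>
    match type of A1 with Rabs (_ - ?r) <= _ =>
    match type of A2' with Rabs (_ - ?s) <= _ =>
    replace (a * p + (1 - a) * q - z)
      with (a * (p - r) + (1 - a) * (q - s) + - (z - (h - ppow m y)))
      by (rewrite Lin; ring) end end end.
  apply Rle_trans with (1 := Rabs_triang _ _).
  rewrite Rabs_Ropp.
  apply Rle_trans with (1 := Rplus_le_compat_r _ _ _ (Rabs_triang _ _)).
  rewrite !Rabs_mult, (Rabs_pos_eq a), (Rabs_pos_eq (1 - a)) by lra.
  apply Rle_trans with (1 := Rplus_le_compat _ _ _ _ (Rplus_le_compat _ _ _ _
    (Rmult_le_compat_l a _ _ ltac:(lra) A1)
    (Rmult_le_compat_l (1 - a) _ _ ltac:(lra) A2')) A3).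
  right. ring.
Qed.

Lemma profile_map_fixed_point (theta a m : R) :
  0 < theta < 1 -> 0 < a < 1 -> 0 < m -> mode_factor theta a m = 1 ->
  exists k, admissible (/ (1 - theta)) k /\
    (forall y, k y = profile_map theta a k y) /\
    exists C, 0 <= C /\
      forall y, Rabs (k y - (/ (1 - theta) - ppow m y)) <= C * ppow (2 * m) y.
Proof.
  intros Ht Ha Hm E.
  set (h := / (1 - theta)).
  assert (Hh : 0 < h) by (apply Rinv_0_lt_compat; lra).
  (* In the weight with exponent [m] the factor would be 1, so the iteration is run with exponent
     [2 m]. *)
  set (q := mode_factor theta a (2 * m)).
  assert (Hq : 0 <= q < 1).
  { split; [apply mode_factor_ge_0 | apply mode_factor_double_lt_1]; lra. }
  set (u := fun n => Nat.iter n (profile_map theta a) (initial_profile h m)).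
  assert (Hu : forall n, admissible h (u n)).
  { intros n. induction n as [|n IH].
    - now apply initial_profile_admissible.
    - now apply admissible_profile_map. }
  destruct (initial_profile_map theta a m Ht Ha Hm E) as [C [HC H0]].
  assert (Hs : forall n y, Rabs (u (S n) y - u n y) <= C * q ^ n * ppow (2 * m) y).
  { intros n. induction n as [|n IH]; intros y.
    - rewrite pow_O, Rmult_1_r. apply H0.
    - replace (C * q ^ S n) with (C * q ^ n * q) by (simpl; ring).
      apply (profile_map_contracts theta a (2 * m) (C * q ^ n) (u (S n)) (u n));
        auto; lra. }
  destruct (geometric_limit_fun u (ppow (2 * m)) C q Hq Hs) as [k Hk].
  assert (HC' : 0 <= C / (1 - q)) by (apply Rle_mult_inv_pos; lra).
  assert (Ak : admissible h k)
    by (apply (admissible_limit u k h (2 * m) (C / (1 - q)) q); auto; lra).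
  exists k. split; [easy | split].
  - intros y. apply Rminus_diag_uniq.
    apply Rabs_eq_0. apply Rle_antisym; [| apply Rabs_pos].
    (* Both [k] and its image are close to [u (S n)]: the former by convergence, the latter by
       contraction applied to [u n] and [k]. *)
    apply (le_of_geometric _ (C / (1 - q) * 2 * ppow (2 * m) y * q) q Hq).
    intros n.
    assert (B1 := Hk (S n) y).
    assert (B2 := profile_map_contracts theta a (2 * m) (C / (1 - q) * q ^ n) (u n) k
      Ht Ha ltac:(lra) (Hu n) Ak ltac:(intros x; rewrite Rabs_minus_sym; apply Hk) y).
    fold q in B2. change (profile_map theta a (u n) y) with (u (S n) y) in B2.
    replace (k y - profile_map theta a k y)
      with ((k y - u (S n) y) + (u (S n) y - profile_map theta a k y)) by ring.
    apply Rle_trans with (1 := Rabs_triang _ _).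
    apply Rle_trans with (1 := Rplus_le_compat _ _ _ _ B1 B2).
    right. simpl. ring.
  - exists (C / (1 - q) + / h). split.
    + apply Rplus_le_le_0_compat; [easy |]. left. now apply Rinv_0_lt_compat.
    + intros y.
      replace (k y - (h - ppow m y)) with ((k y - u O y) + (u O y - (h - ppow m y))) by ring.
      apply Rle_trans with (1 := Rabs_triang _ _).
      apply Rle_trans with (1 := Rplus_le_compat _ _ _ _ (Hk O y)
        (initial_profile_expansion h m y Hh)).
      rewrite pow_O. right. ring.
Qed.

(** * Positivity and strict monotonicity of the fixed point *)

Lemma fixed_point_pos (theta a h m C : R) (k : R -> R) :
  0 < theta < 1 -> 0 < a < 1 -> 0 < h -> 0 < m -> 0 <= C ->
  admissible h k -> (forall y, k y = profile_map theta a k y) ->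
  (forall y, Rabs (k y - (h - ppow m y)) <= C * ppow (2 * m) y) ->
  forall y, 0 < k y.
Proof.
  intros Ht Ha Hh Hm HC [Ck [Bk _]] Fk Ek y.
  (* For [p = y^m] below both bounds, [p + C p^2 <= (1 + C) p < h]. *)
  assert (He : 0 < Rmin 1 (h / (1 + C))).
  { apply Rmin_case; [lra |]. apply Rdiv_lt_0_compat; lra. }
  destruct (ppow_small m _ Hm He) as [d [Hd Hs]].
  assert (Hnear : forall x, x < d -> 0 < k x).
  { intros x Hx. specialize (Hs x Hx). specialize (Ek x).
    rewrite ppow_double in Ek. apply Rabs_le_between in Ek.
    assert (P := ppow_ge_0 m x). set (p := ppow m x) in *.
    assert (p < 1) by (apply Rlt_le_trans with (1 := Hs); apply Rmin_l).
    assert (Q : p < h / (1 + C)) by (apply Rlt_le_trans with (1 := Hs); apply Rmin_r).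
    apply Rlt_div_r in Q; [| lra].
    assert (C * p ^ 2 <= C * p) by (apply Rmult_le_compat_l; nra). lra. }
  (* The average over [(0,1)] sees arguments near 0, which spreads positivity from there to every
     [y]. *)
  rewrite Fk. unfold profile_map. apply Rplus_le_lt_0_compat.
  - apply Rmult_le_pos; [lra |]. apply RInt_ge_0; [lra | |].
    + apply continuous_ex_RInt. now apply continuous_scaled_square.
    + intros r _. apply pow2_ge_0.
  - apply Rmult_lt_0_compat; [lra |].
    assert (A := Rabs_pos y).
    apply (RInt_pos_of_pos_near_0 _ (d / (Rabs y + 1))).
    + now apply continuous_scaled.
    + intros r _. apply Bk.
    + apply Rdiv_lt_0_compat; lra.
    + intros r [Hr0 Hr]. apply Hnear. apply Rlt_div_r in Hr; [| lra].
      generalize (Rle_abs y). nra.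
Qed.

(* Dilations commute with the monotone map, so the weak inequality
   [k (y * r) <= k (x * r)], strict for small [r] by the expansion at 0,
   becomes strict at [r = 1]. *)
Lemma fixed_point_strictly_decreasing (theta a h m C : R) (k : R -> R) :
  0 < theta < 1 -> 0 < a < 1 -> 0 < m -> 0 <= C ->
  admissible h k -> (forall y, k y = profile_map theta a k y) ->
  (forall y, Rabs (k y - (h - ppow m y)) <= C * ppow (2 * m) y) ->
  forall x y, 0 <= x < y -> k y < k x.
Proof.
  intros Ht Ha Hm HC [Ck [Bk Dk]] Fk Ek x y Hxy.
  rewrite (Fk x), (Fk y). unfold profile_map.
  apply Rplus_le_lt_compat.
  - apply Rmult_le_compat_l; [lra |]. apply RInt_le; [lra | | |];
      try (apply continuous_ex_RInt; now apply continuous_scaled_square).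
    intros r Hr. apply pow_incr. split; [apply Bk |]. apply Dk. nra.
  - apply Rmult_lt_compat_l; [lra |].
    apply Rminus_lt_0.
    assert (Cx := continuous_scaled k x Ck). assert (Cy := continuous_scaled k y Ck).
    assert (E := RInt_minus _ _ 0 1 (continuous_ex_RInt _ 0 1 Cx)
                   (continuous_ex_RInt _ 0 1 Cy)).
    change (RInt (fun r => k (x * r) - k (y * r)) 0 1
            = RInt (fun r => k (x * r)) 0 1 - RInt (fun r => k (y * r)) 0 1) in E.
    rewrite <- E.
    assert (L := ppow_lt m x y Hm Hxy). assert (Px := ppow_ge_0 m x).
    set (X := ppow m x) in *. set (Y := ppow m y) in *.
    assert (HB : 0 < C * (X ^ 2 + Y ^ 2) + 1) by
      (generalize (pow2_ge_0 X) (pow2_ge_0 Y); nra).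
    (* With [s = r^m], the expansions give [k (x r) - k (y r) >= s ((Y - X) - C (X^2 + Y^2) s)]; the
       threshold makes the bracket positive. *)
    destruct (ppow_small m ((Y - X) / (C * (X ^ 2 + Y ^ 2) + 1)) Hm) as [d [Hd Hs]].
    { apply Rdiv_lt_0_compat; lra. }
    apply (RInt_pos_of_pos_near_0 _ d); auto.
    + intros r. now apply (continuous_minus (fun r => k (x * r)) (fun r => k (y * r))).
    + intros r Hr. apply Rge_le, Rge_minus, Rle_ge, Dk. nra.
    + intros r Hr. specialize (Hs r ltac:(lra)).
      assert (Ex := Ek (x * r)). assert (Ey := Ek (y * r)).
      rewrite ppow_double, ppow_mult in Ex, Ey by lra.
      fold X in Ex. fold Y in Ey.
      apply Rabs_le_between in Ex. apply Rabs_le_between in Ey.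
      apply Rlt_div_r in Hs; [| lra].
      assert (S : 0 < ppow m r) by (rewrite ppow_pos by lra; apply exp_pos).
      set (s := ppow m r) in *.
      assert (0 < s * ((Y - X) - C * (X ^ 2 + Y ^ 2) * s)) by
        (apply Rmult_lt_0_compat; lra).
      nra.
Qed.

(** * Integral and differential equations for the fixed point *)

Lemma fixed_point_integral_eq (theta a : R) (k : R -> R) :
  (forall x, continuous k x) -> (forall y, k y = profile_map theta a k y) ->
  forall y, y * k y = a * RInt (fun s => k s ^ 2) (theta * y) y
                      + (1 - a) * RInt k 0 y.
Proof.
  intros Ck Fk y. rewrite Fk. unfold profile_map.
  assert (E1 := RInt_scaled (fun x => k x ^ 2) y theta 1 (continuous_square k Ck)).
  assert (E2 := RInt_scaled k y 0 1 Ck).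
  rewrite !Rmult_1_r in E1, E2. rewrite Rmult_0_r in E2.
  rewrite (Rmult_comm theta y), <- E1, <- E2. ring.
Qed.

Lemma is_derive_RInt_from_0 (f : R -> R) : (forall x, continuous f x) ->
  forall y, is_derive (fun y => RInt f 0 y) y (f y).
Proof.
  intros Hf y. apply (is_derive_RInt f (fun y => RInt f 0 y) 0); [| apply Hf].
  exists (mkposreal 1 Rlt_0_1). intros z _.
  apply (@RInt_correct R_CompleteNormedModule). now apply continuous_ex_RInt.
Qed.

(** Continuity of [k] makes the integral expression for [y k y] differentiable, so [k] gains a
    derivative. Dividing by [y] contributes [- k y / y], which turns the coefficient [1 - a] of
    [k y] into [- a]. *)
Lemma fixed_point_ode (theta a : R) (k : R -> R) :
  (forall x, continuous k x) -> (forall y, k y = profile_map theta a k y) ->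
  forall y, 0 < y ->
  is_derive k y (a * (k y ^ 2 - k y - theta * k (theta * y) ^ 2) / y).
Proof.
  intros Ck Fk y Hy.
  set (K := fun y => RInt k 0 y). set (K2 := fun y => RInt (fun s => k s ^ 2) 0 y).
  assert (DK : forall y, is_derive K y (k y)) by exact (is_derive_RInt_from_0 k Ck).
  assert (DK2 : forall y, is_derive K2 y (k y ^ 2))
    by exact (is_derive_RInt_from_0 _ (continuous_square k Ck)).
  assert (Eq : forall z, z * k z = a * (K2 z - K2 (theta * z)) + (1 - a) * K z).
  { intros z. rewrite (fixed_point_integral_eq theta a k Ck Fk).
    assert (Ch : Rplus (K2 (theta * z)) (RInt (fun s => k s ^ 2) (theta * z) z) = K2 z).
    { apply (RInt_Chasles (fun s => k s ^ 2));
        apply continuous_ex_RInt; now apply continuous_square. }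
    rewrite <- Ch. unfold K. ring. }
  (* From here only the derivatives of the primitives matter; opaque, they are abstract functions
     for [auto_derive]. *)
  clearbody K K2.
  apply (is_derive_ext_loc
           (fun z => (a * (K2 z - K2 (theta * z)) + (1 - a) * K z) / z)).
  - apply (filter_imp (fun z => 0 < z)); [| now apply open_gt].
    intros z Hz. rewrite <- Eq. simpl. field. lra.
  - auto_derive.
    + repeat apply conj.
      * exact (ex_intro _ _ (DK2 y)).
      * exact (ex_intro _ _ (DK2 (theta * y))).
      * exact (ex_intro _ _ (DK y)).
      * lra.
      * exact I.
    + rewrite (is_derive_unique (fun z : R => K z) _ _ (DK y)),
        (is_derive_unique (fun z : R => K2 z) _ _ (DK2 y)),
        (is_derive_unique (fun z : R => K2 z) _ _ (DK2 (theta * y))).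
      replace (a * (K2 y + - K2 (theta * y)) + (1 - a) * K y) with (y * k y)
        by apply Eq.
      field. lra.
Qed.

(** * Asymptotics at infinity *)

Lemma le_of_derive_nonneg (f df : R -> R) :
  (forall x, 1 <= x -> is_derive f x (df x)) -> (forall x, 1 <= x -> 0 <= df x) ->
  forall x y, 1 <= x <= y -> f x <= f y.
Proof.
  intros Hd Hp x y Hxy.
  destruct (Req_dec x y) as [->|Hne]; [lra |].
  destruct (MVT_cor3 f df x y ltac:(lra)) as [c [Hc [_ E]]].
  { intros z Hz _. apply is_derive_Reals. apply Hd. lra. }
  rewrite E. specialize (Hp c ltac:(lra)). nra.
Qed.

Lemma le_of_derive_nonpos (f df : R -> R) :
  (forall x, 1 <= x -> is_derive f x (df x)) -> (forall x, 1 <= x -> df x <= 0) ->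
  forall x y, 1 <= x <= y -> f y <= f x.
Proof.
  intros Hd Hp x y Hxy.
  apply Ropp_le_cancel.
  apply (le_of_derive_nonneg (fun x => - f x) (fun x => - df x)); auto.
  - intros z Hz. apply @is_derive_opp. now apply Hd.
  - intros z Hz. specialize (Hp z Hz). lra.
Qed.

Lemma bounded_nondecreasing_lim (f : R -> R) (M : R) :
  (forall x y, 1 <= x <= y -> f x <= f y) -> (forall x, 1 <= x -> f x <= M) ->
  exists l : R, is_lim f p_infty l.
Proof.
  intros Hf HM.
  destruct (completeness (fun z => exists x, 1 <= x /\ z = f x)) as [l [Hub Hlub]].
  - exists M. intros z [x [Hx ->]]. now apply HM.
  - exists (f 1). exists 1. split; [lra | easy].
  - exists l. apply is_lim_spec. intros eps.
    destruct (Classical_Prop.classic (exists x, 1 <= x /\ l - eps < f x))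
      as [[x [Hx Hl]]|N].
    + exists x. intros y Hy.
      assert (f y <= l) by (apply Hub; exists y; split; lra || easy).
      assert (f x <= f y) by (apply Hf; lra).
      apply Rabs_def1; lra.
    + exfalso. assert (l <= l - eps); [| generalize (cond_pos eps); lra].
      apply Hlub. intros z [x [Hx ->]]. apply Rnot_lt_le. intros H.
      apply N. now exists x.
Qed.

Lemma is_lim_exp_neg_ln (d : R) : 0 < d ->
  is_lim (fun y => exp (- d * ln y)) p_infty 0.
Proof.
  intros Hd. apply (is_lim_comp exp (fun y => - d * ln y) p_infty 0 m_infty).
  - apply is_lim_exp_m.
  - replace m_infty with (Rbar_mult (- d) p_infty).
    + apply is_lim_scal_l. apply is_lim_ln_p.
    + simpl. destruct (Rle_dec 0 (- d)); [exfalso; lra | easy].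
  - now exists 0.
Qed.

(* [u -+ (B/d) y^(-d)] are monotone. *)
Lemma lim_of_derive_decay (u du : R -> R) (B d : R) : 0 < d ->
  (forall x, 1 <= x -> is_derive u x (du x / x)) ->
  (forall x, 1 <= x -> Rabs (du x) <= B * exp (- d * ln x)) ->
  exists l : R, is_lim u p_infty l.
Proof.
  intros Hd Hu Hb.
  set (E := fun x => exp (- d * ln x)).
  assert (DE : forall c x, 1 <= x ->
     is_derive (fun x => u x + c * E x) x ((du x - c * d * E x) / x)).
  { intros c x Hx. unfold E.
    replace ((du x - c * d * exp (- d * ln x)) / x)
      with (du x / x + c * (- d * / x * exp (- d * ln x))) by (field; lra).
    apply (is_derive_plus u (fun x => c * exp (- d * ln x))); [now apply Hu |].
    auto_derive; [lra | field; lra]. }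
  assert (HB : 0 <= B).
  { specialize (Hb 1 ltac:(lra)). rewrite ln_1, Rmult_0_r, exp_0 in Hb.
    generalize (Rabs_pos (du 1)). lra. }
  assert (Up : forall x y, 1 <= x <= y -> u x + - (B / d) * E x <= u y + - (B / d) * E y).
  { apply (le_of_derive_nonneg (fun x => u x + - (B / d) * E x) _ (DE (- (B / d)))).
    intros x Hx. apply Rle_mult_inv_pos; [| lra].
    specialize (Hb x Hx). apply Rabs_le_between in Hb.
    replace (- (B / d) * d * E x) with (- (B * E x)) by (field; lra).
    unfold E. lra. }
  assert (Dn : forall x y, 1 <= x <= y -> u y + B / d * E y <= u x + B / d * E x).
  { apply (le_of_derive_nonpos (fun x => u x + B / d * E x) _ (DE (B / d))).
    intros x Hx. apply Ropp_le_cancel. rewrite Ropp_0.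
    unfold Rdiv at 1. rewrite <- Ropp_mult_distr_l_reverse.
    apply Rle_mult_inv_pos; [| lra].
    specialize (Hb x Hx). apply Rabs_le_between in Hb.
    replace (B / d * d * E x) with (B * E x) by (field; lra).
    unfold E. lra. }
  assert (PE : forall x, 0 <= B / d * E x).
  { intros x. apply Rmult_le_pos; [now apply Rle_mult_inv_pos |].
    left. apply exp_pos. }
  (* The nondecreasing combination lies below the nonincreasing one, hence below the value of the
     latter at 1. *)
  destruct (bounded_nondecreasing_lim _ (u 1 + B / d * E 1) Up) as [l Hl].
  { intros x Hx. generalize (Dn 1 x ltac:(lra)) (PE x). lra. }
  exists l.
  apply (is_lim_ext (fun x => (u x + - (B / d) * E x) + B / d * E x)).
  { intros x. ring. }
  replace (Finite l) with (Finite (l + B / d * 0)) by (f_equal; ring).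
  apply is_lim_plus'; [easy |].
  apply (is_lim_scal_l E (B / d) p_infty 0). now apply is_lim_exp_neg_ln.
Qed.

(** Adding [a ln y] cancels the constant [- a] in [y k' / k]. The rest,
    [a (k y - theta k(theta y)^2 / k y)], decays like a power once [k] does and the delayed value is
    comparable to [k y]. *)
Lemma fixed_point_tail (theta a : R) (k : R -> R) :
  0 < theta < 1 -> 0 < a < 1 ->
  admissible (/ (1 - theta)) k -> (forall y, k y = profile_map theta a k y) ->
  (forall y, 0 < k y) -> k 1 < / (1 - theta) ->
  exists l : R, is_lim (fun y => a * ln y + ln (k y)) p_infty l.
Proof.
  intros Ht Ha [Ck [Bk Dk]] Fk Pk K1.
  set (h := / (1 - theta)) in *.
  assert (Hh : 0 < h) by (apply Rinv_0_lt_compat; lra).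
  (* Used with [c = d] for the preliminary decay and with [c = a] for the limit. *)
  assert (Dlog : forall c y, 1 <= y -> is_derive (fun y => c * ln y + ln (k y)) y
     ((c + a * (k y - 1 - theta * k (theta * y) ^ 2 / k y)) / y)).
  { intros c y Hy.
    assert (D := fixed_point_ode theta a k Ck Fk y ltac:(lra)).
    assert (P := Pk y).
    auto_derive.
    - repeat apply conj; [lra | exact (ex_intro _ _ D) | exact P | exact I].
    - rewrite (is_derive_unique (fun z : R => k z) _ _ D). field. lra. }
  set (d := a * (1 - k 1 / h)).
  assert (Hd : 0 < d).
  { apply Rmult_lt_0_compat; [lra |].
    apply Rlt_Rminus. apply Rlt_div_l; lra. }
  (* Monotonicity of [k] reduces the delay equation to the logistic inequality
     [y k' <= - a k (1 - k / h)]. *)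
  assert (Decay : forall y, 1 <= y -> k y <= k 1 * exp (- d * ln y)).
  { intros y Hy.
    assert (M := le_of_derive_nonpos _ _ (Dlog d)).
    assert (M1 : d * ln y + ln (k y) <= d * ln 1 + ln (k 1)).
    { apply M; [| lra]. clear y Hy. intros y Hy.
      apply Ropp_le_cancel. rewrite Ropp_0.
      unfold Rdiv at 1. rewrite <- Ropp_mult_distr_l_reverse.
      apply Rle_mult_inv_pos; [| lra].
      assert (k y <= k 1) by (apply Dk; lra).
      assert (k y <= k (theta * y)) by (apply Dk; nra).
      assert (P := Pk y).
      assert (S : theta * k y <= theta * k (theta * y) ^ 2 / k y).
      { apply (proj1 (Rle_div_r _ _ _ (Rlt_gt _ _ P))). rewrite Rmult_assoc.
        apply Rmult_le_compat_l; [lra |]. nra. }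
      assert (Q : d = a * (1 - k 1 * (1 - theta))).
      { unfold d, h. field. lra. }
      assert (k y * (1 - theta) <= k 1 * (1 - theta))
        by (apply Rmult_le_compat_r; lra).
      rewrite Q, <- Rmult_plus_distr_l, Ropp_mult_distr_r.
      apply Rmult_le_pos; lra. }
    rewrite ln_1, Rmult_0_r, Rplus_0_l in M1.
    rewrite <- (exp_ln (k y)), <- (exp_ln (k 1)), <- exp_plus by apply Pk.
    apply Rnot_lt_le. intros H. apply exp_lt_inv in H. lra. }
  (* Only the part of the linear average over [[0,theta]] is kept; there monotonicity gives
     [k (y r) >= k (theta y)]. *)
  assert (Harnack : forall y, 1 <= y -> k (theta * y) * ((1 - a) * theta) <= k y).
  { intros y Hy. rewrite (Fk y). unfold profile_map.
    assert (Cy := continuous_scaled k y Ck).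
    apply Rle_trans with ((1 - a) * RInt (fun r => k (y * r)) 0 1).
    - rewrite (Rmult_comm (k (theta * y))), Rmult_assoc.
      apply Rmult_le_compat_l; [lra |].
      rewrite <- (RInt_Chasles (fun r => k (y * r)) 0 theta 1);
        try now apply continuous_ex_RInt.
      apply Rle_trans with (RInt (fun r => k (y * r)) 0 theta + 0).
      + rewrite Rplus_0_r.
        assert (E : RInt (fun _ => k (theta * y)) 0 theta = theta * k (theta * y)).
        { rewrite RInt_const. change ((theta - 0) * k (theta * y) = theta * k (theta * y)).
          ring. }
        rewrite <- E. apply RInt_le; [lra | apply ex_RInt_const | |].
        * now apply continuous_ex_RInt.
        * intros r Hr. apply Dk. nra.
      + apply Rplus_le_compat_l. apply RInt_ge_0; [lra | |].
        * now apply continuous_ex_RInt.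
        * intros r _. apply Bk.
    - assert (0 <= RInt (fun r => k (y * r) ^ 2) theta 1).
      { apply RInt_ge_0; [lra | |].
        - apply continuous_ex_RInt. now apply continuous_scaled_square.
        - intros r _. apply pow2_ge_0. }
      nra. }
  set (A := / ((1 - a) * theta)).
  assert (HA : 0 < A) by (apply Rinv_0_lt_compat; apply Rmult_lt_0_compat; lra).
  apply (lim_of_derive_decay _ (fun y => a + a * (k y - 1 - theta * k (theta * y) ^ 2 / k y))
           (a * (1 + theta * A ^ 2) * k 1) d Hd (Dlog a)).
  intros y Hy. assert (P := Pk y).
  replace (a + a * (k y - 1 - theta * k (theta * y) ^ 2 / k y))
    with (a * (k y - theta * k (theta * y) ^ 2 / k y)) by ring.
  rewrite Rabs_mult, (Rabs_pos_eq a) by lra.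
  rewrite !Rmult_assoc. apply Rmult_le_compat_l; [lra |].
  apply Rle_trans with ((1 + theta * A ^ 2) * k y).
  - assert (H1 : k (theta * y) <= A * k y).
    { specialize (Harnack y Hy).
      apply (Rmult_le_compat_r A) in Harnack; [| lra].
      unfold A in Harnack at 1. rewrite Rmult_assoc, Rinv_r, Rmult_1_r in Harnack;
        [lra |]. apply Rmult_integral_contrapositive. lra. }
    assert (H2 : 0 <= theta * k (theta * y) ^ 2 / k y <= theta * A ^ 2 * k y).
    { split.
      - apply Rle_mult_inv_pos; [| easy].
        apply Rmult_le_pos; [lra | apply pow2_ge_0].
      - apply Rle_div_l; [easy |].
        replace (theta * A ^ 2 * k y * k y) with (theta * (A * k y) ^ 2) by ring.
        apply Rmult_le_compat_l; [lra |]. apply pow_incr. split; [apply Bk | easy]. }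
    apply Rabs_le. nra.
  - apply Rmult_le_compat_l; [nra |]. now apply Decay.
Qed.

(** * The exponent [mu] *)

Lemma theta_bounds (gamma : R) : gamma < 1 -> 0 < theta gamma < 1.
Proof.
  intros Hg. unfold theta. split; [apply exp_pos |].
  apply Rlt_le_trans with (Rpower 2 0); [apply Rpower_lt | rewrite Rpower_O]; lra.
Qed.

Lemma is_mu_unique (gamma beta : R) : gamma < 1 -> 0 < beta ->
  exists! mu, is_mu gamma beta mu.
Proof.
  intros Hg Hb.
  assert (Ht := theta_bounds gamma Hg).
  set (h := / (1 - theta gamma)).
  assert (Hh : 0 < h) by (apply Rinv_0_lt_compat; lra).
  set (phi := fun mu => (1 + beta * mu) / 2 - h * (1 - Rpower 2 (gamma - 1 - mu))).
  set (dphi := fun mu => beta / 2 - h * ln 2 * Rpower 2 (gamma - 1 - mu)).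
  assert (Hphi : forall mu, is_mu gamma beta mu <-> 0 < mu /\ phi mu = 0).
  { intros mu. unfold is_mu, phi, h, theta, Rdiv. rewrite (Rmult_comm (1 - _) (/ _)).
    split; intros [H1 H2]; split; lra. }
  assert (P0 : phi 0 < 0).
  { unfold phi. rewrite Rminus_0_r. fold (theta gamma).
    replace (h * (1 - theta gamma)) with 1 by (unfold h; field; lra). lra. }
  assert (D : forall mu, derivable_pt_lim phi mu (dphi mu)).
  { intros mu. apply is_derive_Reals. unfold phi, dphi, Rpower.
    auto_derive; [easy | unfold Rminus; field]. }
  assert (L2 : 0 < ln 2) by (rewrite <- ln_1; apply ln_increasing; lra).
  (* At the right end [(1 + beta mu) / 2 = 1 / 2 + h], which already exceeds the subtracted term,
     itself below [h]. *)
  destruct (IVT phi 0 (2 * h / beta)) as [mu [Hmu E]].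
  - intros x. apply derivable_continuous_pt. eexists. apply D.
  - apply Rdiv_lt_0_compat; lra.
  - exact P0.
  - unfold phi. replace (beta * (2 * h / beta)) with (2 * h) by (field; lra).
    assert (0 < h * Rpower 2 (gamma - 1 - 2 * h / beta))
      by (apply Rmult_lt_0_compat; [easy | apply exp_pos]).
    lra.
  - assert (Hpos : 0 < mu).
    { destruct (Req_dec mu 0) as [->|]; lra. }
    (* Two positive zeros are impossible since [phi 0 < 0] and [phi] is
       strictly convex. *)
    assert (U : forall m1 m2, 0 < m1 -> m1 < m2 -> phi m1 = 0 -> phi m2 = 0 -> False).
    { intros m1 m2 H1 H12 E1 E2.
      destruct (MVT_cor2 phi dphi 0 m1 H1 (fun c _ => D c)) as [c1 [Q1 C1]].
      destruct (MVT_cor2 phi dphi m1 m2 H12 (fun c _ => D c)) as [c2 [Q2 C2]].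
      assert (S1 : 0 < dphi c1) by nra.
      assert (S2 : dphi c2 = 0) by nra.
      assert (S3 : dphi c1 < dphi c2); [| lra].
      unfold dphi. apply Rplus_lt_compat_l, Ropp_lt_contravar.
      apply Rmult_lt_compat_l; [now apply Rmult_lt_0_compat |].
      apply Rpower_lt; lra. }
    exists mu. split; [now apply Hphi |].
    intros mu' H'. apply Hphi in H'. destruct H' as [H' E'].
    destruct (total_order_T mu mu') as [[H|H]|H]; [| easy |]; exfalso.
    + now apply (U mu mu').
    + now apply (U mu' mu).
Qed.

(** Multiplying the equation for [mu] by [2 a] and using [a beta = 1 / (1 - gamma)], the numerator
    of the factor becomes [a + mu / (1 - gamma) + (1 - a)], which is its denominator. *)
Lemma is_mu_mode_factor (gamma beta mu : R) :
  gamma < 1 -> beta_star gamma < beta -> is_mu gamma beta mu ->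
  mode_factor (theta gamma) (beta_star gamma / beta) (mu / (1 - gamma)) = 1.
Proof.
  intros Hg Hb [Hmu E]. assert (Ht := theta_bounds gamma Hg).
  assert (Hb0 : 0 < beta).
  { apply Rlt_trans with (2 := Hb). unfold beta_star. apply Rdiv_lt_0_compat; lra. }
  assert (P : theta gamma * ppow (mu / (1 - gamma)) (theta gamma)
              = Rpower 2 (gamma - 1 - mu)).
  { rewrite ppow_pos by lra. unfold theta. rewrite Rpower_mult, <- Rpower_plus.
    f_equal. field. lra. }
  unfold mode_factor. rewrite P. fold (theta gamma) in E.
  apply (f_equal (fun z => 2 * z)) in E.
  replace (2 * / (1 - theta gamma) * (beta_star gamma / beta)
           * (1 - Rpower 2 (gamma - 1 - mu)))
    with (2 * ((1 - Rpower 2 (gamma - 1 - mu)) / (1 - theta gamma))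
          * (beta_star gamma / beta)) by (field; lra).
  rewrite <- E. unfold beta_star. field. lra.
Qed.

(** * The change of variables [y = x^(1-gamma)] *)

Lemma continuous_Rpower (p x : R) : 0 < x -> continuous (fun s => Rpower s p) x.
Proof.
  intros Hx. apply (@ex_derive_continuous R_AbsRing R_NormedModule).
  eexists. now apply is_derive_Rpower.
Qed.

(** Here [dy = (1 - gamma) s^(-gamma) ds], and [beta_star] is the inverse of the constant. *)
Lemma is_RInt_power_subst (f : R -> R) (gamma p q : R) :
  gamma < 1 -> (forall x, continuous f x) -> 0 < p -> 0 < q ->
  is_RInt (fun s => Rpower s (- gamma) * f (Rpower s (1 - gamma))) p q
    (beta_star gamma * (RInt f 0 (Rpower q (1 - gamma)) - RInt f 0 (Rpower p (1 - gamma)))).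
Proof.
  intros Hg Hf Hp Hq.
  set (F := fun y => RInt f 0 y).
  assert (DF : forall y, is_derive F y (f y)) by exact (is_derive_RInt_from_0 f Hf).
  replace (beta_star gamma * _) with
    (minus (beta_star gamma * F (Rpower q (1 - gamma)))
           (beta_star gamma * F (Rpower p (1 - gamma))))
    by (unfold minus, plus, opp, F; simpl; ring).
  clearbody F.
  apply (is_RInt_derive (fun s => beta_star gamma * F (Rpower s (1 - gamma)))).
  - intros s Hs. assert (Hs0 : 0 < s).
    { apply Rlt_le_trans with (2 := proj1 Hs). now apply Rmin_case. }
    assert (DR := is_derive_Rpower (1 - gamma) s Hs0).
    auto_derive.
    + repeat apply conj;
        [exact (ex_intro _ _ (DF _)) | exact (ex_intro _ _ DR) | exact I].
    + rewrite (is_derive_unique (fun z : R => F z) _ _ (DF _)), 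
        (is_derive_unique (fun z : R => Rpower z (1 - gamma)) _ _ DR).
      replace (1 - gamma - 1) with (- gamma) by ring.
      unfold beta_star. field. lra.
  - intros s Hs. assert (Hs0 : 0 < s).
    { apply Rlt_le_trans with (2 := proj1 Hs). now apply Rmin_case. }
    apply (continuous_mult (fun s => Rpower s (- gamma))
                           (fun s => f (Rpower s (1 - gamma)))).
    + now apply continuous_Rpower.
    + apply (continuous_comp (fun s => Rpower s (1 - gamma)) f); [| apply Hf].
      now apply continuous_Rpower.
Qed.

Lemma at_right_0_pos : at_right 0 (fun x => 0 < x).
Proof. exists (mkposreal 1 Rlt_0_1). now intros x _ Hx. Qed.

Lemma filterlim_Rpower_0 (f : R -> R) (p : R) : 0 < p ->
  (forall x, continuous f x) ->
  filterlim (fun x => f (Rpower x p)) (at_right 0) (locally (f 0)).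
Proof.
  intros Hp Hf.
  apply (filterlim_ext_loc (fun x => f (ppow p x))).
  - apply (filter_imp _ _ (fun x Hx => f_equal f (ppow_pos p x Hx))).
    apply at_right_0_pos.
  - assert (C : continuous (fun x => f (ppow p x)) 0).
    { apply continuous_comp; [now apply continuous_ppow | apply Hf]. }
    unfold continuous in C. rewrite (ppow_npos p 0) in C by lra.
    apply (filterlim_filter_le_1 _ (filter_le_within (F := locally 0) _) C).
Qed.

(** The integral over [[p,x]] is a continuous function of [p^(1-gamma)], which tends to 0 with [p];
    this covers the singular weight when [gamma > 0]. *)
Lemma is_RInt_gen_power_subst (f : R -> R) (gamma x : R) :
  gamma < 1 -> (forall x, continuous f x) -> 0 < x ->
  is_RInt_gen (fun s => Rpower s (- gamma) * f (Rpower s (1 - gamma)))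
    (at_right 0) (at_point x)
    (beta_star gamma * RInt f 0 (Rpower x (1 - gamma))).
Proof.
  intros Hg Hf Hx P HP.
  set (F := fun y => beta_star gamma
                     * (RInt f 0 (Rpower x (1 - gamma)) - RInt f 0 y)).
  assert (CF : forall y, continuous F y).
  { intros y. unfold F.
    apply (continuous_scal_R (fun y => RInt f 0 (Rpower x (1 - gamma)) - RInt f 0 y)).
    intros z. apply (continuous_minus (fun _ => RInt f 0 (Rpower x (1 - gamma)))
                       (fun y => RInt f 0 y)).
    - apply continuous_const.
    - apply (@ex_derive_continuous R_AbsRing R_NormedModule).
      eexists. now apply is_derive_RInt_from_0. }
  assert (F0 : F 0 = beta_star gamma * RInt f 0 (Rpower x (1 - gamma))).
  { unfold F. rewrite RInt_point. f_equal. apply Rminus_0_r. }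
  rewrite <- F0 in HP.
  assert (L := filterlim_Rpower_0 F (1 - gamma) ltac:(lra) CF P HP).
  apply (Filter_prod _ _ _ (fun p => 0 < p /\ P (F (Rpower p (1 - gamma))))
                           (fun q => q = x)).
  - apply filter_and; [apply at_right_0_pos | exact L].
  - reflexivity.
  - intros p q [Hp HPp] ->. exists (F (Rpower p (1 - gamma))). split; [| easy].
    now apply is_RInt_power_subst.
Qed.

Lemma Rpower_half (gamma x : R) : 0 < x ->
  Rpower (x / 2) (1 - gamma) = theta gamma * Rpower x (1 - gamma).
Proof.
  intros Hx. unfold theta. replace x with (2 * (x / 2)) at 2 by field.
  rewrite <- Rpower_mult_distr, <- Rmult_assoc, <- Rpower_plus by lra.
  replace (gamma - 1 + (1 - gamma)) with 0 by ring.
  rewrite Rpower_O by lra. ring.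
Qed.

(** * The profile in the original variable *)

Definition profile_of (gamma : R) (k : R -> R) (x : R) : R :=
  Rpower x (- (1 + gamma)) * k (Rpower x (1 - gamma)).

(** This integrand and the quadratic one acquire the same weight [s^(-gamma)], so one substitution
    serves both integrals. *)
Lemma profile_of_moment (gamma : R) (k : R -> R) (s : R) : 0 < s ->
  s * profile_of gamma k s = Rpower s (- gamma) * k (Rpower s (1 - gamma)).
Proof.
  intros Hs. unfold profile_of. rewrite <- Rmult_assoc.
  rewrite <- (Rpower_1 s) at 1 by easy. rewrite <- Rpower_plus.
  f_equal. f_equal. ring.
Qed.

Lemma profile_of_square (gamma : R) (k : R -> R) (s : R) :
  Rpower s (2 + gamma) * profile_of gamma k s ^ 2
  = Rpower s (- gamma) * k (Rpower s (1 - gamma)) ^ 2.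
Proof.
  unfold profile_of.
  replace (- gamma) with (2 + gamma + (- (1 + gamma) + - (1 + gamma))) by ring.
  rewrite !Rpower_plus. ring.
Qed.

Lemma is_RInt_gen_ext_pos (f g : R -> R) (x l : R) : 0 < x ->
  (forall s, 0 < s -> f s = g s) ->
  is_RInt_gen f (at_right 0) (at_point x) l ->
  is_RInt_gen g (at_right 0) (at_point x) l.
Proof.
  intros Hx E. apply is_RInt_gen_ext.
  apply (Filter_prod _ _ _ (fun p => 0 < p) (fun q => q = x)).
  - apply at_right_0_pos.
  - reflexivity.
  - intros p q Hp -> s Hs. apply E. simpl in Hs.
    apply Rlt_trans with (2 := proj1 Hs). now apply Rmin_case.
Qed.

Lemma profile_of_solution (gamma beta : R) (k : R -> R) :
  gamma < 1 -> 0 < beta -> (forall x, continuous k x) ->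
  (forall y, k y = profile_map (theta gamma) (beta_star gamma / beta) k y) ->
  profile_solution gamma beta (profile_of gamma k).
Proof.
  intros Hg Hb Ck Fk.
  assert (Ck2 := continuous_square k Ck).
  assert (I1 : forall x, 0 < x -> is_RInt_gen (fun s => s * profile_of gamma k s)
            (at_right 0) (at_point x) (beta_star gamma * RInt k 0 (Rpower x (1 - gamma)))).
  { intros x Hx. apply (is_RInt_gen_ext_pos
      (fun s => Rpower s (- gamma) * k (Rpower s (1 - gamma)))); [easy | |].
    - intros s Hs. symmetry. now apply profile_of_moment.
    - now apply is_RInt_gen_power_subst. }
  split; [| split; [| split]].
  - intros x Hx. eexists. now apply I1.
  - intros x Hx. eexists. apply (is_RInt_gen_ext_pos
      (fun s => Rpower s (- gamma) * k (Rpower s (1 - gamma)) ^ 2)); [easy | |].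
    + intros s Hs. symmetry. apply profile_of_square.
    + now apply (is_RInt_gen_power_subst (fun y => k y ^ 2)).
  - apply (filterlim_ext_loc (fun x => Rpower x (1 - gamma) * k (Rpower x (1 - gamma)))).
    + apply (filter_imp (fun x => 0 < x)); [| apply at_right_0_pos].
      intros x Hx.
      replace (x ^ 2 * profile_of gamma k x) with (x * (x * profile_of gamma k x)) by ring.
      rewrite profile_of_moment, <- Rmult_assoc by easy. f_equal.
      rewrite <- (Rpower_1 x) at 2 by easy. rewrite <- Rpower_plus.
      f_equal.
    + rewrite <- (Rmult_0_l (k 0)) at 2.
      apply (filterlim_Rpower_0 (fun y => y * k y)); [lra |].
      intros y. apply (continuous_mult (fun y => y) k); [apply continuous_id | apply Ck].
  - intros x Hx.
    rewrite (is_RInt_gen_unique _ _ (I1 x Hx)).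
    assert (I2 := is_RInt_power_subst (fun y => k y ^ 2) gamma (x / 2) x Hg Ck2
                    ltac:(lra) Hx).
    rewrite (RInt_ext _ (fun s => Rpower s (- gamma) * k (Rpower s (1 - gamma)) ^ 2))
      by (intros s _; apply profile_of_square).
    rewrite (is_RInt_unique _ _ _ _ I2), Rpower_half by easy.
    set (y := Rpower x (1 - gamma)).
    assert (Ch : Rplus (RInt (fun s => k s ^ 2) 0 (theta gamma * y))
                   (RInt (fun s => k s ^ 2) (theta gamma * y) y)
                 = RInt (fun s => k s ^ 2) 0 y).
    { apply (RInt_Chasles (fun s => k s ^ 2)); now apply continuous_ex_RInt. }
    rewrite <- Ch.
    assert (E := fixed_point_integral_eq _ _ k Ck Fk y).
    replace (beta * x ^ 2 * profile_of gamma k x) with (beta * (y * k y)).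
    (* The constants match because [beta a = beta_star] and [(1 - gamma) beta_star = 1]. *)
    + rewrite E. unfold beta_star. field. lra.
    + replace (beta * x ^ 2 * profile_of gamma k x)
        with (beta * (x * (x * profile_of gamma k x))) by ring.
      rewrite profile_of_moment by easy. fold y.
      rewrite <- (Rmult_assoc x). f_equal. f_equal. unfold y.
      rewrite <- (Rpower_1 x) at 2 by easy. rewrite <- Rpower_plus.
      f_equal.
Qed.

Lemma profile_of_expansion (gamma mu C : R) (k : R -> R) :
  gamma < 1 -> 0 < mu -> 0 <= C ->
  (forall y, Rabs (k y - (/ (1 - theta gamma) - ppow (mu / (1 - gamma)) y))
             <= C * ppow (2 * (mu / (1 - gamma))) y) ->
  expansion_at_zero gamma mu 1 (profile_of gamma k).
Proof.
  intros Hg Hmu HC Ek.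
  exists (fun x => k (Rpower x (1 - gamma)) - / (1 - theta gamma) + Rpower x mu).
  split.
  - intros eps.
    (* In the variable [x] the remainder is at most [C x^(2 mu)], so [x^mu < eps / (C + 1)]
       suffices. *)
    assert (He : 0 < eps / (C + 1)) by (apply Rdiv_lt_0_compat; [apply eps | lra]).
    destruct (ppow_small mu _ Hmu He) as [d [Hd Hs]].
    exists (mkposreal d Hd). intros x Hx Hx0.
    change (Rabs (x - 0) < d) in Hx. rewrite Rminus_0_r in Hx.
    specialize (Hs x (Rle_lt_trans _ _ _ (Rle_abs x) Hx)).
    rewrite ppow_pos in Hs by easy.
    specialize (Ek (Rpower x (1 - gamma))).
    rewrite ppow_double, ppow_pos, Rpower_mult in Ek by apply exp_pos.
    replace ((1 - gamma) * (mu / (1 - gamma))) with mu in Ek by (field; lra).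
    change (Rabs (k (Rpower x (1 - gamma)) - / (1 - theta gamma) + Rpower x mu)
            <= eps * Rabs (Rpower x mu)).
    replace (k (Rpower x (1 - gamma)) - / (1 - theta gamma) + Rpower x mu)
      with (k (Rpower x (1 - gamma)) - (/ (1 - theta gamma) - Rpower x mu)) by ring.
    apply Rle_trans with (1 := Ek).
    assert (P : 0 < Rpower x mu) by apply exp_pos.
    rewrite Rabs_pos_eq by lra.
    apply Rlt_div_r in Hs; [| lra]. nra.
  - intros x Hx. unfold profile_of. f_equal. unfold Rdiv. ring.
Qed.

Lemma profile_of_rescaled (gamma : R) (k : R -> R) (x : R) : 0 < x ->
  Rpower x (1 + gamma) * profile_of gamma k x = k (Rpower x (1 - gamma)).
Proof.
  intros Hx. unfold profile_of. rewrite <- Rmult_assoc, <- Rpower_plus.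
  rewrite Rplus_opp_r, Rpower_O by easy. ring.
Qed.

Lemma is_lim_Rpower_p (p : R) : 0 < p -> is_lim (fun x => Rpower x p) p_infty p_infty.
Proof.
  intros Hp. apply (is_lim_comp exp (fun x => p * ln x) p_infty p_infty p_infty).
  - apply is_lim_exp_p.
  - replace p_infty with (Rbar_mult p p_infty) at 2.
    + apply is_lim_scal_l. apply is_lim_ln_p.
    + simpl. destruct (Rle_dec 0 p) as [H|]; [| exfalso; lra].
      destruct (Rle_lt_or_eq_dec 0 p H); [easy | exfalso; lra].
  - now exists 0.
Qed.

(** With [y = x^(1-gamma)] one has [y^(beta_star/beta) = x^(1/beta)], so the quotient is exactly
    [exp (u y - l)]. *)
Lemma profile_of_asymp (gamma beta l : R) (k : R -> R) :
  gamma < 1 -> 0 < beta -> (forall y, 0 < k y) ->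
  is_lim (fun y => beta_star gamma / beta * ln y + ln (k y)) p_infty l ->
  asymp_at_infty (profile_of gamma k)
    (fun x => exp l / Rpower x (1 + gamma + 1 / beta)).
Proof.
  intros Hg Hb Pk Hl. unfold asymp_at_infty.
  set (u := fun y => beta_star gamma / beta * ln y + ln (k y)) in *.
  apply (is_lim_ext_loc (fun x => exp (u (Rpower x (1 - gamma)) - l))).
  - exists 0. intros x Hx. unfold u, Rpower at 1.
    rewrite ln_exp. unfold Rminus at 1. rewrite !exp_plus, exp_Ropp, exp_ln by apply Pk.
    unfold profile_of. rewrite Rpower_plus.
    replace (Rpower x (- (1 + gamma))) with (/ Rpower x (1 + gamma))
      by (symmetry; apply Rpower_Ropp).
    replace (exp (beta_star gamma / beta * ((1 - gamma) * ln x)))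
      with (Rpower x (1 / beta)).
    + assert (0 < Rpower x (1 + gamma)) by apply exp_pos.
      assert (0 < Rpower x (1 / beta)) by apply exp_pos.
      assert (0 < exp l) by apply exp_pos.
      field. lra.
    + unfold Rpower. f_equal. unfold beta_star. field. lra.
  - replace (Finite 1) with (Finite (exp (l - l))) by now rewrite Rminus_diag, exp_0.
    apply is_lim_comp_continuous.
    + apply is_lim_minus'; [| apply is_lim_const].
      apply (is_lim_comp u _ p_infty l p_infty Hl).
      * apply is_lim_Rpower_p. lra.
      * now exists 0.
    + apply continuity_pt_filterlim, derivable_continuous_pt, derivable_pt_exp.
Qed.

Theorem theorem1p1 :
  forall gamma beta : R, gamma < 1 -> beta_star gamma < beta ->
    (exists! mu : R, is_mu gamma beta mu) /\
    (forall mu : R, is_mu gamma beta mu ->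
       exists g : R -> R,
         profile_solution gamma beta g /\
         (exists c : R, 0 < c /\ expansion_at_zero gamma mu c g) /\
         decreasing_on_positives (fun x => Rpower x (1 + gamma) * g x) /\
         (exists d : R, 0 < d /\
            asymp_at_infty g
              (fun x => d / Rpower x (1 + gamma + 1 / beta)))).
Proof.
  intros gamma beta Hg Hb.
  assert (Hbs : 0 < beta_star gamma) by (apply Rdiv_lt_0_compat; lra).
  assert (Hb0 : 0 < beta) by lra.
  split; [now apply is_mu_unique |].
  intros mu Hmu.
  assert (Ht := theta_bounds gamma Hg).
  set (a := beta_star gamma / beta).
  assert (Ha : 0 < a < 1).
  { split; [now apply Rdiv_lt_0_compat | apply Rlt_div_l; lra]. }
  assert (Hmu0 : 0 < mu) by apply Hmu.
  set (m := mu / (1 - gamma)).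
  assert (Hm : 0 < m) by (apply Rdiv_lt_0_compat; lra).
  assert (Hh : 0 < / (1 - theta gamma)) by (apply Rinv_0_lt_compat; lra).
  destruct (profile_map_fixed_point (theta gamma) a m Ht Ha Hm
              (is_mu_mode_factor gamma beta mu Hg Hb Hmu))
    as [k [Ak [Fk [C [HC Ek]]]]].
  assert (Pk := fixed_point_pos _ _ _ m C k Ht Ha Hh Hm HC Ak Fk Ek).
  assert (Sk := fixed_point_strictly_decreasing _ _ _ m C k Ht Ha Hm HC Ak Fk Ek).
  assert (K1 : k 1 < / (1 - theta gamma)).
  { apply Rlt_le_trans with (k 0); [apply Sk; lra | apply Ak]. }
  destruct (fixed_point_tail _ a k Ht Ha Ak Fk Pk K1) as [l Hl].
  exists (profile_of gamma k). split; [| split; [| split]].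
  - apply profile_of_solution; auto. apply Ak.
  (* The value 1 is the normalization of the [y^m] term; dilations of [k] would produce the other
     positive constants. *)
  - exists 1. split; [lra |]. now apply (profile_of_expansion gamma mu C).
  - intros x y Hx Hxy. rewrite !profile_of_rescaled by lra.
    apply Sk. split; [left; apply exp_pos |].
    apply Rlt_Rpower_l; lra.
  - exists (exp l). split; [apply exp_pos |]. now apply profile_of_asymp.
Qed.
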